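(* Let $Q$ be an $\mathfrak{F}$-primary ideal of $O$ and let $k=\max\{n\in\mathbb{N} : \mathfrak{F}^n\supseteq Q\}$. Then: (i) $Q= f^{k-1} Q'$, where $Q'$ is an $\mathfrak{F}$-basic ideal of $O$. (ii) If $Q/f^m$ is an $\mathfrak{F}$-basic ideal of $O$ for some integer $m > 0$, then $m = k - 1$.
   Context: Let $d$ be a square-free integer ($d\neq 1$), $K=\mathbb{Q}(\sqrt d)$ and $D=\mathbb{Z}[\omega]$ its ring of integers, where $\omega=\sqrt d$ if $d\equiv 2,3 \pmod 4$ and $\omega=(1+\sqrt d)/2$ if $d\equiv 1\pmod 4$. Let $f$ be a prime number and $O=\mathbb{Z}[f\omega]$, the unique order of $K$ with $[D:O]=f$. The conductor of $O$ is $\mathfrak{F}=\{x\in O: xD\subseteq O\}=fD$; it is a prime ideal of $O$, and $\mathfrak{F}^n=f^{n-1}\mathfrak{F}$ for $n\ge 1$. An ideal $Q$ of $O$ is $\mathfrak{F}$-primary if it is primary with radical $\mathfrak{F}$. An $\mathfrak{F}$-primary ideal is $\mathfrak{F}$-basic if it is not contained in $\mathfrak{F}^2$. $Q/f^m$ denotes $f^{-m}Q=\{f^{-m}x: x\in Q\}\subseteq K$. *)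

(* Defs.v *)
From mathcomp Require Import all_boot all_order all_algebra all_field.
From mathcomp Require Import classical_sets.

Set Implicit Arguments.
Unset Strict Implicit.
Unset Printing Implicit Defensive.

Import Order.TTheory GRing.Theory Num.Theory.
Local Open Scope ring_scope.
Local Open Scope classical_set_scope.

(* 0 is not square-free for this definition. *)
Definition squarefree_int (d : int) : Prop :=
  forall m : int, (m ^+ 2 %| d)%Z -> `|m| = 1.

(* Subrings of a field K, their ideals and their fractional ideals are all
   represented as subsets of K; [O] always stands for the ambient subring. *)
Section Ideals.
Variable K : fieldType.
Implicit Types (O D I J Q : set K).

(* The ring Z[a]. *)
Definition Zadjoin (a : K) : set K :=
  range (fun p : {poly int} => (map_poly intr p).[a]).

Definition is_ideal O I : Prop :=
  [/\ I `<=` O, I 0,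
      (forall x y, I x -> I y -> I (x + y))
    & (forall a x, O a -> I x -> I (a * x))].

Definition primary_ideal O Q : Prop :=
  [/\ is_ideal O Q, Q <> O
    & (forall a b, O a -> O b -> Q (a * b) ->
         Q a \/ exists n : nat, Q (b ^+ n.+1))].

Definition radical O I : set K :=
  [set x | O x /\ exists n : nat, I (x ^+ n.+1)].

Definition ideal_mul I J : set K :=
  [set x | exists (n : nat) (a b : 'I_n -> K),
     [/\ (forall i, I (a i)), (forall i, J (b i))
       & x = \sum_(i < n) a i * b i]].

(* The zeroth power of an ideal is the whole ring. *)
Definition ideal_pow O I (n : nat) : set K := iter n (ideal_mul I) O.

(* The conductor of O in the overring D. *)
Definition conductor O D : set K :=
  [set x | O x /\ forall y, D y -> O (x * y)].

Definition P_primary O P Q : Prop := primary_ideal O Q /\ radical O Q = P.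

Definition P_basic O P Q : Prop :=
  P_primary O P Q /\ ~ (Q `<=` ideal_pow O P 2).

Definition scale_set (c : K) Q : set K := [set c * x | x in Q].

(* The standard generator of the maximal order of Q(s), where s ^+ 2 = d. *)
Definition quad_omega (d : int) (s : K) : K :=
  if (d %% 4)%Z == 1 then (1 + s) / 2%:R else s.

Definition max_order (d : int) (s : K) : set K := Zadjoin (quad_omega d s).

Definition order_of_index (d : int) (s : K) (f : nat) : set K :=
  Zadjoin (f%:R * quad_omega d s).

Definition order_conductor (d : int) (s : K) (f : nat) : set K :=
  conductor (order_of_index d s f) (max_order d s).

End Ideals.

Definition is_max_nat (P : nat -> Prop) (k : nat) : Prop :=
  P k /\ forall n, P n -> (n <= k)%N.

(* Main.v *)
Require Import Defs.
From mathcomp Require Import all_boot all_order all_algebra all_field.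
From mathcomp Require Import boolp classical_sets.
From mathcomp Require Import zify ring.

Import Order.TTheory GRing.Theory Num.Theory.
Local Open Scope ring_scope.
Local Open Scope classical_set_scope.

(** Write [D] for the maximal order and [F] for the conductor.  The whole
    argument rests on the fact that [F] is principal over [D]: [F = f D].
    Consequently [F ^ n = f ^ n D] for [n >= 1], so that dividing an ideal by
    [f] shifts the filtration by the powers of [F] by exactly one step
    ([ideal_pow_scale], [scale_set_subP]).

    Let [Q] be [F]-primary.  Some power [f ^ N] lies in [Q], whereas [1] is not
    in [F = f D]; hence [Q] cannot be contained in [f ^ n D] for [n > N], and
    [k] exists ([primary_bound]).  Because [Q] is contained in
    [F ^ k = f ^ (k - 1) F], the set [Q' = f ^ -(k - 1) Q] is an ideal of [O]
    contained in [F].  It contains [Q], since [f] is in [O], so the two ideals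
    have the same radical; and it inherits primariness because [a b] is in [Q']
    as soon as [(f ^ (k - 1) a) b] is in [Q] ([primary_descale]).  The shift of
    the filtration turns the maximality of [k] into [Q'] not being contained in
    [F ^ 2], and it also yields (ii): [f ^ -m Q] is contained in [F] but not in
    [F ^ 2] exactly when [Q] is contained in [F ^ (m + 1)] but not in
    [F ^ (m + 2)].

    The arithmetic input is [F = f D] ([conductor_quadratic]).  Since [omega] is
    a root of a monic quadratic polynomial over the integers,
    [D = Z + Z omega] and [O = Z + Z f omega], so [f D] is contained in [O],
    hence in [F].  Conversely let [x = u + v f omega] be in [F]; comparing the
    coefficients of [omega] in [x omega], which must lie in [O], gives
    [f | u].  The comparison is licit because [1] and [omega] are linearly
    independent over the integers, that is, because [d] is not a square. *)

(** * Ideals between an overring and its multiple *)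

Section Scaling.
Variable K : fieldType.
Implicit Types (a b c x : K) (A B D O Q R : set K).

Definition subring_set R : Prop :=
  [/\ R 1, (forall x y, R x -> R y -> R (x - y))
    & (forall x y, R x -> R y -> R (x * y))].

Lemma subring_set0 {R} : subring_set R -> R 0.
Proof. by case=> R1 RB _; rewrite -(subrr 1); apply: RB. Qed.

Lemma subring_setD {R} : subring_set R -> forall x y, R x -> R y -> R (x + y).
Proof.
move=> sR x y Rx Ry; have [_ RB _] := sR.
rewrite -[y]opprK -[- y]sub0r; apply: (RB _ _ Rx); apply: RB => //.
exact: subring_set0 sR.
Qed.

Lemma subring_setX {R} : subring_set R -> forall x n, R x -> R (x ^+ n).
Proof.
case=> R1 _ RM x n Rx; elim: n => [|n IHn]; first by rewrite expr0.
by rewrite exprS; apply: (RM).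
Qed.

Lemma scale_setP c A x : c != 0 -> scale_set c A x <-> A (c^-1 * x).
Proof.
move=> c0; split=> [[y Ay <-]|Ax]; first by rewrite mulKf.
by exists (c^-1 * x) => //; rewrite mulVKf.
Qed.

Lemma scale_setA a b A : scale_set a (scale_set b A) = scale_set (a * b) A.
Proof.
apply/seteqP; split=> x.
  by case=> _ [y Ay <-] <-; exists y => //; rewrite mulrA.
by case=> y Ay <-; exists (b * y); [exists y | rewrite mulrA].
Qed.

Lemma scale_set1 A : scale_set 1 A = A.
Proof. by rewrite /scale_set; under eq_imagel do rewrite mul1r; exact: image_id. Qed.

(** Multiplication by [c] is a bijection of [K], so it can be cancelled from an
    inclusion; this is how inclusions move along the filtration. *)
Lemma scale_set_subP c A B :
  c != 0 -> scale_set c A `<=` scale_set c B <-> A `<=` B.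
Proof.
move=> c0; split=> sAB x.
  move=> Ax; have /sAB : scale_set c A (c * x) by exists x.
  by move/(scale_setP _ _ _ c0); rewrite mulKf.
by case=> y /sAB By <-; exists y.
Qed.

Lemma scale_subring_expS c D i j :
  subring_set D -> D c -> (i <= j)%N ->
  scale_set (c ^+ j) D `<=` scale_set (c ^+ i) D.
Proof.
move=> sD Dc le_ij _ [y Dy <-]; have [_ _ DM] := sD.
exists (c ^+ (j - i) * y); first by apply: DM => //; apply: subring_setX.
by rewrite mulrA -exprD subnKC.
Qed.

(** The unit of [O] already generates [D] as a [D]-module, so the product of
    [a D] with [b O] fills up [a b D]. *)
Lemma ideal_mul_scale a b O D :
  subring_set D -> O 1 -> O `<=` D ->
  ideal_mul (scale_set a D) (scale_set b O) = scale_set (a * b) D.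
Proof.
move=> sD O1 sOD; have [_ _ DM] := sD; apply/seteqP; split=> x.
  case=> n [u [v [Du Ov ->]]].
  apply: (big_ind (scale_set (a * b) D)).
  - by exists 0; rewrite ?mulr0 //; apply: subring_set0.
  - move=> _ _ [y Dy <-] [z Dz <-]; exists (y + z); last by rewrite mulrDr.
    exact: subring_setD.
  - move=> i _; have [[y Dy <-] [z /sOD Dz <-]] := (Du i, Ov i).
    by exists (y * z); [apply: DM | rewrite mulrACA].
case=> y Dy <-; exists 1%N, (fun=> a * y), (fun=> b * 1); split=> [_|_|].
- by exists y.
- by exists 1.
- by rewrite big_ord1 mulr1 mulrAC.
Qed.

Lemma ideal_pow_scale c O D n :
  subring_set D -> O 1 -> O `<=` D ->
  ideal_pow O (scale_set c D) n.+1 = scale_set (c ^+ n.+1) D.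
Proof.
move=> sD O1 sOD; have [D1 _ _] := sD; elim: n => [|n IHn].
  by rewrite /ideal_pow /= -[O in ideal_mul _ O]scale_set1 ideal_mul_scale ?mulr1.
by rewrite exprS -(ideal_mul_scale _ _ _ _ sD D1 (@subset_refl _ D)) -IHn.
Qed.

(** * Primary ideals whose radical is the multiple *)

Lemma P_primary_sub O P Q : P_primary O P Q -> Q `<=` P.
Proof. by case=> -[[sQO _ _ _] _ _] <- x Qx; split; [apply: sQO | exists 0%N]. Qed.

Lemma P_primary_not1 O P Q : P_primary O P Q -> ~ P 1.
Proof.
case=> -[[sQO _ _ QM] neQO _] <- [_ [n]]; rewrite expr1n => Q1.
by apply: neQO; apply/seteqP; split=> // x Ox; rewrite -[x]mulr1; apply: QM.
Qed.

Section Filtration.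
Variables (c : K) (O D : set K).
Hypotheses (c0 : c != 0) (sD : subring_set D) (O1 : O 1) (sOD : O `<=` D).
Hypothesis scDO : scale_set c D `<=` O.
Let F := scale_set c D.

Lemma scale_set_unit : F c.
Proof. by case: sD => D1 _ _; exists 1; rewrite ?mulr1. Qed.
Let Oc : O c := scDO _ scale_set_unit.

Lemma is_ideal_mulX Q n x : is_ideal O Q -> Q x -> Q (c ^+ n * x).
Proof.
case=> _ _ _ QM Qx; elim: n => [|n IHn]; first by rewrite expr0 mul1r.
by rewrite exprS -mulrA; apply: QM.
Qed.

(** If [c ^+ N.+1], which lies in [Q] for some [N], were in [c ^+ n D] with
    [n > N.+1], then [1] would be in [c D]. *)
Lemma primary_bound Q : P_primary O F Q ->
  exists N, forall n, Q `<=` ideal_pow O F n -> (n <= N)%N.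
Proof.
move=> prQ; have F'1 := P_primary_not1 _ _ _ prQ; case: prQ => _ radQ.
have [_ [N QcN]] : radical O Q c by rewrite radQ; apply: scale_set_unit.
exists N.+1 => -[//|n]; rewrite ideal_pow_scale // => /(_ _ QcN) FcN.
rewrite leqNgt; apply/negP => ltNn; apply: F'1.
have [x Dx] := scale_subring_expS _ _ _ _ sD (sOD _ Oc) ltNn _ FcN.
rewrite exprSr -mulrA -[RHS]mulr1 => /(mulfI (expf_neq0 _ c0)) <-.
by exists x.
Qed.

(** The quotient contains [Q], because [c] is in [O], and is contained in the
    radical of [Q]; so both have the same radical. *)
Lemma primary_descale Q j :
  P_primary O F Q -> Q `<=` scale_set (c ^+ j.+1) D ->
  P_primary O F (scale_set (c ^+ j)^-1 Q).
Proof.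
move=> prQ sQ; have F'1 := P_primary_not1 _ _ _ prQ.
have [[idQ _ Qpr] radQ] := prQ; have [sQO Q0 QD QM] := idQ.
have cj0 : c ^+ j != 0 by rewrite expf_neq0.
set Q' := scale_set _ Q.
have Q'P x : Q' x <-> Q (c ^+ j * x).
  by rewrite -[c ^+ j]invrK; apply: scale_setP; rewrite invr_eq0.
have sQQ' : Q `<=` Q' by move=> x Qx; apply/Q'P; apply: is_ideal_mulX.
have sQ'F : Q' `<=` F.
  move=> x /Q'P /sQ [y Dy]; rewrite exprSr -mulrA => /(mulfI cj0) <-.
  by exists y.
split; first split; first split.
- by move=> x /sQ'F; apply: scDO.
- by apply/Q'P; rewrite mulr0.
- by move=> x y /Q'P Qx /Q'P Qy; apply/Q'P; rewrite mulrDr; apply: QD.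
- by move=> a x Oa /Q'P Qx; apply/Q'P; rewrite mulrCA; apply: QM.
- by move=> Q'O; apply: F'1; apply: sQ'F; rewrite Q'O.
- move=> a b Oa Ob /Q'P; rewrite mulrA => Qab.
  have Ocja : O (c ^+ j * a).
    elim: j {sQ cj0 Q' Q'P sQQ' sQ'F Qab} => [|j _]; first by rewrite mul1r.
    apply: scDO; exists (c ^+ j * a); last by rewrite exprS mulrA.
    have [_ _ DM] := sD; apply: DM; last exact: sOD.
    exact: (subring_setX sD _ _ (sOD _ Oc)).
  case: (Qpr _ _ Ocja Ob Qab) => [/Q'P|[n /sQQ']]; first by left.
  by right; exists n.
- apply/seteqP; split=> x.
    case=> Ox [n /sQ'F]; rewrite -radQ => -[_ [m]].
    by rewrite -exprM mulSn addSn => Qx; split=> //; eexists; exact: Qx.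
  by rewrite -[X in X x -> _]radQ => -[Ox [n /sQQ' Qx]]; split=> //; exists n.
Qed.

Lemma basic_descale Q j :
  P_primary O F Q -> Q `<=` ideal_pow O F j.+1 ->
  ~ Q `<=` ideal_pow O F j.+2 ->
  P_basic O F (scale_set (c ^+ j)^-1 Q).
Proof.
have cj0 : c ^+ j != 0 by rewrite expf_neq0.
rewrite !ideal_pow_scale // => prQ sQ nsQ; split; first exact: primary_descale.
rewrite ideal_pow_scale // => /(scale_set_subP _ _ _ cj0).
by rewrite !scale_setA divff // scale_set1 -exprD addn2.
Qed.

Lemma basic_scale_inv Q j : P_basic O F (scale_set (c ^+ j)^-1 Q) ->
  Q `<=` ideal_pow O F j.+1 /\ ~ Q `<=` ideal_pow O F j.+2.
Proof.
have cj0 : c ^+ j != 0 by rewrite expf_neq0.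
case=> /P_primary_sub sQ nsQ; rewrite !ideal_pow_scale //; split.
  move/(scale_set_subP _ _ _ cj0): sQ.
  by rewrite !scale_setA divff // scale_set1 -exprSr.
move=> sQ2; apply: nsQ; rewrite ideal_pow_scale //.
apply/(scale_set_subP _ _ _ cj0).
by rewrite !scale_setA divff // scale_set1 -exprD addn2.
Qed.

Lemma ideal_pow_le i j : (i <= j)%N -> ideal_pow O F j `<=` ideal_pow O F i.
Proof.
have sDexp i' j' := scale_subring_expS c D i' j' sD (sOD _ Oc).
case: j i => [|j] [|i] // leij; first exact: subset_refl.
  by rewrite ideal_pow_scale //; exact: subset_trans (sDexp 1%N j.+1 isT) scDO.
by rewrite !ideal_pow_scale //; exact: sDexp.
Qed.

End Filtration.

End Scaling.

Lemma bounded_is_max_nat (P : nat -> Prop) n N :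
  P n -> (forall i, P i -> (i <= N)%N) -> exists k, is_max_nat P k.
Proof.
move=> Pn leN; pose p i := `[< P i >].
have exp : exists i, p i by exists n; apply/asboolP.
have lep i : p i -> (i <= N)%N by move/asboolP; apply: leN.
have [k /asboolP Pk maxk] := ex_maxnP exp lep.
by exists k; split=> // i Pi; apply: maxk; apply/asboolP.
Qed.

(** * Quadratic orders and their conductors *)

Section QuadraticOrders.
Variable K : fieldType.
Implicit Types (a x : K) (n t u v : int).

Lemma Zadjoin_subring a : subring_set K (Zadjoin a).
Proof.
split.
- by exists 1; rewrite // rmorph1 hornerC.
- by move=> _ _ [p _ <-] [q _ <-]; exists (p - q); rewrite // rmorphB !hornerE.
- by move=> _ _ [p _ <-] [q _ <-]; exists (p * q); rewrite // rmorphM !hornerE.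
Qed.

Lemma Zadjoin_quadratic a t n : a ^+ 2 = t%:~R * a + n%:~R ->
  forall x, Zadjoin a x <-> exists u v, x = u%:~R + v%:~R * a.
Proof.
move=> qa x; split=> [[p _ <-]|[u [v ->]]]; last first.
  exists (u%:P + v%:P * 'X) => //.
  by rewrite rmorphD rmorphM /= !map_polyC map_polyX !hornerE.
elim/poly_ind: p => [|p c [u [v IHp]]].
  by exists 0, 0; rewrite rmorph0 horner0 mul0r addr0.
exists (c + v * n), (u + v * t).
rewrite rmorphD rmorphM /= map_polyX map_polyC !hornerE IHp mulrDl -mulrA.
by rewrite -expr2 qa /=; ring.
Qed.

(** The inclusion in [f Z[a]] tests an element [x] of the conductor only against
    [a]: the coefficient of [a] in [x a] must be divisible by [f], which forces
    the constant coefficient of [x] to be so, whatever the trace [t] is. *)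
Lemma conductor_quadratic a t n (f : nat) :
  a ^+ 2 = t%:~R * a + n%:~R ->
  (forall u v, u%:~R + v%:~R * a = 0 -> v = 0) ->
  conductor (Zadjoin (f%:R * a)) (Zadjoin a) = scale_set f%:R (Zadjoin a).
Proof.
move=> qa free_a; have DP := Zadjoin_quadratic _ _ _ qa.
have qfa : (f%:R * a) ^+ 2
    = (f%:Z * t)%:~R * (f%:R * a) + (f%:Z ^+ 2 * n)%:~R.
  by rewrite exprMn qa; ring.
have OP := Zadjoin_quadratic _ _ _ qfa.
have [_ _ DM] := Zadjoin_subring a.
have Da : Zadjoin a a by apply/DP; exists 0, 1; ring.
apply/seteqP; split=> x.
  case=> /OP [u [v ->]] /(_ _ Da) /OP [u' [v' eq_xa]].
  (* [eq_xa] reduced modulo the quadratic equation of [a] *)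
  have /free_a/eqP : (v * f%:Z * n - u')%:~R
      + (u + v * f%:Z * t - v' * f%:Z)%:~R * a = 0 :> K.
    transitivity ((u%:~R + v%:~R * (f%:R * a)) * a
        - (u'%:~R + v'%:~R * (f%:R * a))
        - v%:~R * f%:R * (a ^+ 2 - (t%:~R * a + n%:~R))); first by ring.
    by rewrite eq_xa qa !subrr mulr0 subr0.
  rewrite subr_eq0 => /eqP def_u.
  exists ((v' - v * t)%:~R + v%:~R * a); first by apply/DP; do 2!eexists.
  have -> : u = (v' - v * t) * f%:Z by lia.
  by ring.
have sDO y : Zadjoin a y -> Zadjoin (f%:R * a) (f%:R * y).
  by case/DP=> u [v ->]; apply/OP; exists (f%:Z * u), v; ring.
case=> y Dy <-; split; first exact: sDO.
by move=> z Dz; rewrite -mulrA; apply: sDO; apply: DM.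
Qed.

End QuadraticOrders.

(** Otherwise [u ^ 2] divides [v ^ 2], hence [u] divides [v], and [d] is the
    square of the quotient; the only square-free square is [1]. *)
Lemma squarefree_sqr_eq0 (d u v : int) :
  squarefree_int d -> d != 1 -> u ^+ 2 * d = v ^+ 2 -> u = 0.
Proof.
move=> sqf_d d1 duv; apply/eqP/contraT => u0.
have /dvdzP[w def_v] : (u %| v)%Z.
  by rewrite dvdzE -(@dvdn_pexp2r _ _ 2) // -!abszX -dvdzE -duv dvdz_mulr.
have def_d : d = w ^+ 2.
  by apply: (mulfI (expf_neq0 2 u0)); rewrite duv def_v exprMn mulrC.
have := sqf_d w; rewrite def_d => /(_ (dvdzz _)) w1.
by rewrite def_d -real_normK ?num_real // w1 in d1.
Qed.

Section QuadraticField.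
Variables (d : int) (K : fieldExtType rat) (s : K).
Hypotheses (sqf_d : squarefree_int d) (d1 : d != 1) (hs : s ^+ 2 = d%:~R).

Lemma ext_rat_intr_eq0 (z : int) : (z%:~R == 0 :> K) = (z == 0).
Proof.
by rewrite -(rmorph_int (in_alg K)) fmorph_eq0 intr_eq0.
Qed.

Lemma sqrt_free (u v : int) : u%:~R + v%:~R * s = 0 -> v = 0.
Proof.
move=> /eqP; rewrite addrC addr_eq0 => /eqP vs.
apply: (squarefree_sqr_eq0 d v u sqf_d d1); apply/eqP.
rewrite -subr_eq0 -ext_rat_intr_eq0 rmorphB subr_eq0 /=.
by apply/eqP; rewrite intrM !rmorphXn /= -hs -exprMn vs sqrrN.
Qed.

Lemma two_neq0 : 2%:R != 0 :> K.
Proof. by rewrite (ext_rat_intr_eq0 2). Qed.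

Lemma quad_omega_free (u v : int) :
  u%:~R + v%:~R * quad_omega d s = 0 -> v = 0.
Proof.
rewrite /quad_omega; case: ifP => _; last exact: sqrt_free.
move=> uv0; apply: (sqrt_free (2 * u + v)); have two0 := two_neq0.
by rewrite -[RHS](mulr0 2%:R) -uv0; field.
Qed.

Lemma quad_omega_quadratic :
  exists t n : int, quad_omega d s ^+ 2 = t%:~R * quad_omega d s + n%:~R.
Proof.
rewrite /quad_omega; case: ifP => [/eqP dmod|_].
  (* the minimal polynomial is X^2 - X - (d - 1) / 4 *)
  exists 1, (d %/ 4)%Z; have two0 := two_neq0; have four0 : 4%:R != 0 :> K.
    by rewrite (ext_rat_intr_eq0 4).
  have def_d : d = (d %/ 4)%Z * 4 + 1 by rewrite {1}(divz_eq d 4) dmod.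
  have sqr_s : s ^+ 2 = (d %/ 4)%Z%:~R * 4%:R + 1 by rewrite hs {1}def_d; ring.
  have -> : ((1 + s) / 2%:R) ^+ 2 = (1 + 2 * s + s ^+ 2) / 4%:R.
    by field; rewrite four0 two0.
  by rewrite sqr_s; field; rewrite four0 two0.
by exists 0, d; rewrite hs mul0r add0r.
Qed.

End QuadraticField.

Theorem lemma2p5 (d : int) (hd : squarefree_int d) (hd1 : d != 1)
    (K : fieldExtType rat) (s : K) (hs : s ^+ 2 = d%:~R)
    (hK : <<1%VS; s>>%VS = {:K}%VS)
    (f : nat) (hf : prime f) (Q : set K) :
  let O := order_of_index d s f in
  let F := order_conductor d s f in
  P_primary O F Q ->
  (exists k : nat, is_max_nat (fun n => Q `<=` ideal_pow O F n) k) /\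
  (forall k : nat, is_max_nat (fun n => Q `<=` ideal_pow O F n) k ->
     (exists Q' : set K,
        P_basic O F Q' /\ Q = scale_set (f%:R ^ (k%:Z - 1)) Q') /\
     (forall m : int, 0 < m ->
        P_basic O F (scale_set (f%:R ^ (- m)) Q) -> m = k%:Z - 1)).
Proof.
move=> O F.
have [t [n qw]] := quad_omega_quadratic d K s hs.
have free_w := quad_omega_free d K s hd hd1 hs.
have defF : F = scale_set f%:R (max_order d s).
  exact: conductor_quadratic qw free_w.
have f0 : f%:R != 0 :> K.
  by rewrite (ext_rat_intr_eq0 K f) -lt0n prime_gt0.
have sD : subring_set K (max_order d s) := Zadjoin_subring _ _.
have [O1 _ _] : subring_set K O := Zadjoin_subring _ _.
have sFO : scale_set f%:R (max_order d s) `<=` O by rewrite -defF => x [].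
have sOD : O `<=` max_order d s.
  move=> _ [p _ <-]; exists (p \Po (f%:Z%:P * 'X)) => //.
  by rewrite map_comp_poly horner_comp rmorphM /= map_polyC map_polyX !hornerE.
rewrite defF => prQ.
have sQF := P_primary_sub _ _ _ _ prQ.
have [N leN] := primary_bound _ _ _ _ f0 sD O1 sOD sFO _ prQ.
split.
  apply: (bounded_is_max_nat _ 0%N N) leN.
  exact: subset_trans sQF sFO.
move=> k [sQk maxk].
have k_gt0 : (0 < k)%N.
  by apply: maxk; rewrite ideal_pow_scale.
case: k k_gt0 sQk maxk => // j _ sQj maxj.
have -> : j.+1%:Z - 1 = j%:Z by lia.
split.
  exists (scale_set (f%:R ^+ j)^-1 Q); split.
    by apply: basic_descale => // /maxj; rewrite ltnn.
  by rewrite scale_setA divff ?expf_neq0 // scale_set1.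
case=> [m|//] _; rewrite -exprnN.
move=> /(basic_scale_inv _ _ _ _ f0 sD O1 sOD)[sQm nsQm].
have le_mj := maxj _ sQm.
have : ~~ (m.+1 < j.+1)%N.
  apply/negP => lt_mj; apply: nsQm.
  by apply: subset_trans sQj _; apply: ideal_pow_le.
lia.
Qed.
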